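(* Let $r,m\in \mathbb{N}=\{1,2,3,\ldots\}$ with $r\leq m$. The generalized Stirling numbers generated by the operator $\delta_{r,m}=x^r\frac{d^m}{dx^m}$ and those generated by the operator $\delta_{m,r}=x^m\frac{d^r}{dx^r}$ coincide with each other, and the common numbers $S(n,k)$ satisfy the recurrence relation $$S(n,k)=\sum_{i=0}^r \big(m+(m-r)(n-2)+k-i-1\big)_{r-i}\binom{r}{i}\, S(n-1,k-i), \qquad n\ge 2,\; 1\le k\leq 1+r(n-1),$$ with $S(1,1)=1$ and, for $n\ge 1$, $S(n,k)=0$ whenever $k\le 0$ or $k>1+r(n-1)$ (where $r=\min\{r,m\}$).
   Context: All operators act on smooth functions of one variable $x$ (say on $(0,\infty)$), and powers denote composition. $(y)_\lambda = y(y-1)\cdots(y-\lambda+1)$ denotes the falling factorial, with $(y)_0=1$. For $r\le m$ and $n\ge 1$, the generalized Stirling numbers generated by $\delta_{m,r}$ are the coefficients $S_{m,r}(n,k)$ in the normally ordered expansion $$\Big(x^m\frac{d^r}{dx^r}\Big)^n=\sum_{k=1}^{1+r(n-1)} S_{m,r}(n,k)\, x^{\,n(m-r)+r+k-1}\,\frac{d^{\,r+k-1}}{dx^{\,r+k-1}},$$ and those generated by $\delta_{r,m}$ are the coefficients $S_{r,m}(n,k)$ in $$\Big(x^r\frac{d^m}{dx^m}\Big)^n=\sum_{k=1}^{1+r(n-1)} S_{r,m}(n,k)\, x^{\,r+k-1}\,\frac{d^{\,n(m-r)+r+k-1}}{dx^{\,n(m-r)+r+k-1}},$$ with both extended by $0$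 to $k\le 0$ and $k>1+r(n-1)$. The theorem includes that such expansions exist. *)

(* Defs.v *)
From HB Require Import structures.
From mathcomp Require Import all_boot all_order all_algebra.
From mathcomp Require Import all_classical all_reals topology normedtype derive.
Import Order.TTheory GRing.Theory Num.Theory.
Import numFieldNormedType.Exports.

Set Implicit Arguments.
Unset Strict Implicit.
Unset Printing Implicit Defensive.

Local Open Scope ring_scope.

(* Functions are total on R, but only their values on (0, +oo) matter: the
   derivatives at a point x > 0 depend only on the values near x. *)
Definition smooth_pos (R : realType) (f : R -> R) : Prop :=
  forall (n : nat) (x : R), 0 < x -> derivable (f^`(n))%classic x 1.

(* delta a b is the operator x^a d^b/dx^b. *)
Definition delta (R : realType) (a b : nat) (f : R -> R) : R -> R :=
  fun x => x ^+ a * (f^`(b))%classic x.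

(* (y)_l = y (y - 1) ... (y - l + 1) *)
Definition falling (y : int) (l : nat) : int :=
  \prod_(0 <= j < l) (y - j%:Z).

(* The next two predicates, meant for 0 < r <= m, say that the numbers S n k
   (n >= 1; nothing is said about n = 0) are coefficients of the normally
   ordered powers of delta m r, respectively delta r m, extended by 0. The
   truncated subtractions are then exact, because k >= 1. *)
Definition gen_stirling_mr (R : realType) (m r : nat) (S : nat -> int -> R) :
    Prop :=
  forall n : nat, (1 <= n)%N ->
    (forall f : R -> R, smooth_pos f -> forall x : R, 0 < x ->
       iter n (@delta R m r) f x =
       \sum_(1 <= k < (1 + r * (n - 1)).+1)
         S n k%:Z * x ^+ (n * (m - r) + r + k - 1) * (f^`(r + k - 1))%classic x) /\
    (forall k : int, k <= 0 \/ (1 + r * (n - 1))%N%:Z < k -> S n k = 0).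

Definition gen_stirling_rm (R : realType) (m r : nat) (S : nat -> int -> R) :
    Prop :=
  forall n : nat, (1 <= n)%N ->
    (forall f : R -> R, smooth_pos f -> forall x : R, 0 < x ->
       iter n (@delta R r m) f x =
       \sum_(1 <= k < (1 + r * (n - 1)).+1)
         S n k%:Z * x ^+ (r + k - 1) * (f^`(n * (m - r) + r + k - 1))%classic x) /\
    (forall k : int, k <= 0 \/ (1 + r * (n - 1))%N%:Z < k -> S n k = 0).

(* Main.v *)
(* By the Leibniz rule, x^c D^d (x^a D^b) is the sum over p of
   C(d, p) (a)_p x^(c + a - p) D^(b + d - p). Powers of x^m D^r are expanded by
   multiplying by one more factor on the left, powers of x^r D^m by multiplying
   on the right; since C(b, p) (r)_p = C(r, p) (b)_p, both choices lead to the
   same recurrence for the coefficients. The coefficients are determined by the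
   operator, as one sees by applying it to the monomials x^l at x = 1. *)
Require Import Defs.
From mathcomp Require Import all_boot all_order all_algebra.
From mathcomp Require Import all_classical all_reals topology normedtype derive.
From mathcomp Require Import zify ring.
Import Order.TTheory GRing.Theory Num.Theory.
Import numFieldNormedType.Exports.

Local Open Scope ring_scope.

(** * Iterated derivatives on the open half-line: sums, products, powers *)

Lemma near_pos (R : realType) (P : R -> Prop) (x : R) : 0 < x ->
  (forall y, 0 < y -> P y) -> \near x, P x.
Proof.
move=> x0 HP; apply: (@filterS _ _ _ [set y | y > 0]%classic) => //.
exact: (open_nbhs_nbhs (conj (@open_gt _ _) x0)).
Qed.

(** A derivative depends only on the germ of the function and the half-line is open, so identities
    known only for positive arguments may be differentiated. *)
Lemma eq_pos_derive1n (R : realType) (f g : R -> R) :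
  (forall x, 0 < x -> f x = g x) ->
  forall n x, 0 < x -> (f^`(n))%classic x = (g^`(n))%classic x.
Proof.
move=> fg; elim=> [//|n IHn] x x0.
rewrite !derive1nS !derive1E; apply: near_eq_derive.
exact: near_pos x0 IHn.
Qed.

Lemma smooth_pos_is_derive {R : realType} {f : R -> R} (n : nat) {x : R} :
  smooth_pos f -> 0 < x ->
  is_derive x 1 (f^`(n))%classic ((f^`(n.+1))%classic x).
Proof.
by move=> sf x0; rewrite derive1nS derive1E; apply: derivableP; exact: sf.
Qed.

(** Here [F] is a candidate tower of successive derivatives. By induction on the order, the iterated
    derivative agrees with [F n] near each positive point; this gives smoothness and the derivative
    formula at once. *)
Lemma smooth_posI (R : realType) (f : R -> R) (F : nat -> R -> R) :
  (forall x, 0 < x -> f x = F 0%N x) ->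
  (forall n (x : R), 0 < x -> is_derive x 1 (F n) (F n.+1 x)) ->
  smooth_pos f /\ forall n x, 0 < x -> (f^`(n))%classic x = F n x.
Proof.
move=> fF dF.
have DF n x : 0 < x -> (f^`(n))%classic x = F n x.
  elim: n x => [|n IHn] x x0; first exact: fF.
  rewrite derive1nS derive1E (@near_eq_derive _ _ _ _ (F n)); last first.
    exact: near_pos x0 IHn.
  by have [_ ->] := dF n x x0.
split=> // n x x0; apply: (@near_eq_derivable _ _ _ (F n)).
  by apply: near_pos x0 _ => y y0; rewrite DF.
by have [] := dF n x x0.
Qed.

Lemma derive1nD (R : realType) (f : R -> R) (n k : nat) :
  ((f^`(k))^`(n))%classic = (f^`(n + k))%classic.
Proof. by rewrite /derive1n iterD. Qed.

Lemma smooth_pos_derive1n (R : realType) (f : R -> R) (k : nat) :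
  smooth_pos f -> smooth_pos (f^`(k))%classic.
Proof. by move=> sf n x x0; rewrite derive1nD; exact: sf. Qed.

Lemma smooth_pos_sum (R : realType) (p : nat) (c : 'I_p -> R)
    (f : 'I_p -> R -> R) : (forall i, smooth_pos (f i)) ->
  smooth_pos (fun x => \sum_(i < p) c i * f i x) /\
  forall n x, 0 < x -> ((fun x => \sum_(i < p) c i * f i x)^`(n))%classic x =
    \sum_(i < p) c i * ((f i)^`(n))%classic x.
Proof.
move=> sf; apply: smooth_posI => // n x x0.
rewrite [X in is_derive _ _ X _](_ : _ =
  \sum_(i < p) (c i \*: ((f i)^`(n))%classic)).
  apply: is_derive_sum => i.
  exact: is_deriveZ (smooth_pos_is_derive n (sf i) x0).
by apply/funext => y; rewrite fct_sumE.
Qed.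

(** Pascal's rule in the form of the induction step of the Leibniz formula; [u i] and [v i] stand
    for the values at a point of the [i]-th derivatives of the two factors. *)
Lemma sum_binomial_derivation (R : comPzRingType) (u v : nat -> R) (n : nat) :
  \sum_(i < n.+1) 'C(n, i)%:R * (u i.+1 * v (n - i)%N + u i * v (n - i).+1) =
  \sum_(i < n.+2) 'C(n.+1, i)%:R * (u i * v (n.+1 - i)%N).
Proof.
rewrite [RHS]big_ord_recl bin0 subn0.
under [in RHS]eq_bigr => i _ do
  rewrite lift0 binS natrD mulrDl subSS.
rewrite big_split /= [in RHS]big_ord_recr /= bin_small // mul0r addr0.
under eq_bigr do rewrite mulrDr.
rewrite big_split /= addrC addrA; congr (_ + _).
rewrite big_ord_recl bin0 subn0; congr (_ + _).
by apply: eq_bigr => i _; rewrite lift0 -subSn.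
Qed.

Lemma smooth_posM (R : realType) (f g : R -> R) :
  smooth_pos f -> smooth_pos g -> smooth_pos (fun x => f x * g x) /\
  forall n x, 0 < x -> ((fun x => f x * g x)^`(n))%classic x =
    \sum_(i < n.+1) 'C(n, i)%:R *
      ((f^`(i))%classic x * (g^`(n - i))%classic x).
Proof.
move=> sf sg; apply: smooth_posI => [x _|n x x0].
  by rewrite big_ord1 bin0 mul1r.
rewrite -(@sum_binomial_derivation _ (fun i => (f^`(i))%classic x)
  (fun i => (g^`(i))%classic x)).
rewrite [X in is_derive _ _ X _](_ : _ = \sum_(i < n.+1)
  ('C(n, i)%:R \*: ((f^`(i))%classic * (g^`(n - i))%classic))).
  apply: is_derive_sum => i; apply: is_deriveZ.
  rewrite addrC [X in _ + X]mulrC.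
  exact: is_deriveM (smooth_pos_is_derive i sf x0)
    (smooth_pos_is_derive (n - i) sg x0).
by apply/funext => y; rewrite fct_sumE.
Qed.

(** The truncation in [a - n] is harmless: once [n] exceeds [a], the coefficient [a ^_ n] is
    zero. *)
Lemma smooth_posX (R : realType) (a : nat) :
  smooth_pos (fun x : R => x ^+ a) /\
  forall n (x : R), 0 < x ->
    ((fun x : R => x ^+ a)^`(n))%classic x = (a ^_ n)%:R * x ^+ (a - n).
Proof.
apply: smooth_posI => [x _|n x x0]; first by rewrite subn0 mul1r.
rewrite ffactnSr natrM -mulrA subnS -[X in _ * X]mulr1.
have := @is_deriveX R R id (a - n) x 1 1 (is_derive_id _ _).
move=> /(@is_deriveZ _ _ _ _ (a ^_ n)%:R).
by congr (is_derive _ _ _ _); apply/funext => y; rewrite /= exprfctE.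
Qed.

Lemma smooth_pos_delta (R : realType) (a b : nat) (f : R -> R) :
  smooth_pos f -> smooth_pos (@delta R a b f).
Proof.
move=> sf; have sD := smooth_pos_derive1n _ _ b sf.
exact: (smooth_posM _ _ _ (smooth_posX R a).1 sD).1.
Qed.

Lemma derive1n_delta {R : realType} (a b d : nat) {f : R -> R} {x : R} :
  smooth_pos f -> 0 < x ->
  ((@delta R a b f)^`(d))%classic x =
  \sum_(i < d.+1) ('C(d, i) * a ^_ i)%:R *
    (x ^+ (a - i) * (f^`(d - i + b))%classic x).
Proof.
move=> sf x0; have sD := smooth_pos_derive1n _ _ b sf.
rewrite (smooth_posM _ _ _ (smooth_posX R a).1 sD).2 //.
apply: eq_bigr => i _.
by rewrite (smooth_posX _ _).2 // derive1nD natrM !mulrA.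
Qed.

(** * Reindexing of sums and the recurrence of the coefficients *)

Lemma sum_ord_sub (V : nmodType) (r : nat) (F : nat -> V) :
  \sum_(i < r.+1) F i = \sum_(i < r.+1) F (r - i)%N.
Proof.
by rewrite (reindex_inj rev_ord_inj); under eq_bigr do rewrite /= subSS.
Qed.

(** Substitute [k = j + i]. For fixed [i], the new range of [k] lets [j] run up to [B + C - i], at
    least [B], and the added terms vanish by hypothesis. *)
Lemma sum_antidiagonals (V : nmodType) (B C : nat) (G : nat -> nat -> V) :
  (forall j i, (B <= j)%N -> G j i = 0) ->
  \sum_(j < B) \sum_(i < C.+1) G j i =
  \sum_(k < B + C) \sum_(i < C.+1 | (i <= k)%N) G (k - i)%N i.
Proof.
move=> G0; rewrite exchange_big /= [RHS](exchange_big_dep xpredT) //=.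
apply: eq_bigr => i _.
transitivity (\sum_(i <= k < B + C) G (k - i)%N i); last first.
  by rewrite big_geq_mkord.
rewrite -[X in _ = \sum_(X <= _ < _) _]add0n big_addn big_mkord.
have iC := ltn_ord i.
rewrite (@big_ord_widen _ _ _ B (B + C - i) (fun j => G j i)); last by lia.
rewrite big_mkcond; apply: eq_bigr => j _; rewrite addnK.
by case: ltnP => // /G0 ->.
Qed.

(* [stirling m r n k] is the number S(n+1, k+1) of the theorem. *)
Fixpoint stirling (m r n k : nat) : nat :=
  if n is n'.+1 then
    \sum_(i < r.+1 | (i <= k)%N)
      'C(r, i) * (n * (m - r) + r + (k - i)) ^_ (r - i) *
        stirling m r n' (k - i)
  else k == 0%N.

Lemma stirling_eq0 (m r n k : nat) : (r * n < k)%N -> stirling m r n k = 0%N.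
Proof.
elim: n k => [|n IHn] k; first by rewrite muln0 => k0 /=; case: k k0.
move=> lt_k /=; apply: big1 => i _.
by rewrite IHn ?muln0 //; have := ltn_ord i; lia.
Qed.

(** This is the recurrence read as a rule for one more factor of the operator: the term of index [j]
    spreads over the indices [j + i] with [i <= r], and collecting equal indices gives the next row.
    Since [E] is arbitrary, it serves both operators. *)
Lemma stirling_sum (R : comPzRingType) (m r n : nat) (E : nat -> R) :
  \sum_(j < (r * n).+1) (stirling m r n j)%:R *
    (\sum_(i < r.+1)
      ('C(r, i) * (n.+1 * (m - r) + r + j) ^_ (r - i))%:R * E (j + i)%N) =
  \sum_(k < (r * n.+1).+1) (stirling m r n.+1 k)%:R * E k.
Proof.
under eq_bigr do rewrite big_distrr.
rewrite /= (@sum_antidiagonals _ _ _ (fun j i => (stirling m r n j)%:R *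
  (('C(r, i) * (n.+1 * (m - r) + r + j) ^_ (r - i))%:R *
    E (j + i)%N))); last first.
  by move=> j i lt_j; rewrite stirling_eq0 // mul0r.
rewrite (_ : ((r * n).+1 + r)%N = (r * n.+1).+1); last by lia.
apply: eq_bigr => k _; rewrite natr_sum big_distrl; apply: eq_bigr => i ik.
by rewrite subnK // mulrA -natrM mulnC.
Qed.

Lemma bin_ffactC (b r i : nat) : ('C(b, i) * r ^_ i = 'C(r, i) * b ^_ i)%N.
Proof. by rewrite -!bin_ffact; lia. Qed.

(** * Normally ordered powers of the two operators *)

Lemma iter_delta_mr (R : realType) (m r n : nat) (f : R -> R) (x : R) :
  (r <= m)%N -> smooth_pos f -> 0 < x ->
  iter n.+1 (@delta R m r) f x =
  \sum_(k < (r * n).+1) (stirling m r n k)%:R *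
    (x ^+ (n.+1 * (m - r) + r + k) * (f^`(r + k))%classic x).
Proof.
move=> rm sf; elim: n x => [|n IHn] x x0.
  rewrite muln0 big_ord1 /= mul1r mul1n !addn0 /delta.
  by rewrite subnK.
rewrite iterS {1}/delta (eq_pos_derive1n _ _ _ IHn) //.
(* Each term of the expansion is again some [delta a b f], so the Leibniz rule for [delta] applies
   termwise. *)
have sd k := smooth_pos_delta _ (n.+1 * (m - r) + r + k) (r + k) _ sf.
rewrite (smooth_pos_sum _ _ (fun k => (stirling m r n (nat_of_ord k))%:R)
  (fun k : 'I__ => @delta R (n.+1 * (m - r) + r + k) (r + k) f) _).2 //.
rewrite -(stirling_sum _ m r n
  (fun k => x ^+ (n.+2 * (m - r) + r + k) * (f^`(r + k))%classic x)) big_distrr.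
apply: eq_bigr => j _; rewrite /= mulrCA derive1n_delta //; congr (_ * _).
(* Reversing the Leibniz sum makes [i] count the derivatives that pass through to [f], so the order
   becomes [r + j + i], as in [stirling_sum]. *)
rewrite (sum_ord_sub _ r (fun i =>
  ('C(r, i) * (n.+1 * (m - r) + r + j) ^_ i)%:R *
  (x ^+ (n.+1 * (m - r) + r + j - i) * (f^`(r - i + (r + j)))%classic x))).
rewrite big_distrr; apply: eq_bigr => i _.
have ir : (i <= r)%N by rewrite -ltnS.
rewrite /= bin_sub // mulrCA; congr (_ * _).
rewrite mulrA -exprD; congr (_ ^+ _ * _); first by lia.
by congr ((f^`(_))%classic _); lia.
Qed.

Lemma iter_delta_rm (R : realType) (m r n : nat) (f : R -> R) (x : R) :
  (r <= m)%N -> smooth_pos f -> 0 < x ->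
  iter n.+1 (@delta R r m) f x =
  \sum_(k < (r * n).+1) (stirling m r n k)%:R *
    (x ^+ (r + k) * (f^`(n.+1 * (m - r) + r + k))%classic x).
Proof.
(* The new factor is split off on the right, so the induction hypothesis is needed for [delta r m f]
   and must hold for all [f]. *)
move=> rm + x0; elim: n f => [|n IHn] f sf.
  rewrite muln0 big_ord1 /= mul1r mul1n !addn0 /delta.
  by rewrite subnK.
rewrite iterSr IHn; last exact: smooth_pos_delta.
rewrite -(stirling_sum _ m r n
  (fun k => x ^+ (r + k) * (f^`(n.+2 * (m - r) + r + k))%classic x)).
apply: eq_bigr => j _; congr (_ * _).
rewrite derive1n_delta //; set b := (n.+1 * (m - r) + r + j)%N.
have rb : (r < b.+1)%N by rewrite /b; lia.
(* The Leibniz sum runs up to [b], but only [r + 1] terms survive because [r ^_ i] vanishes beyond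
   [r]; [bin_ffactC] then gives the coefficients found for the other operator. *)
rewrite (_ : \sum_(i < b.+1) _ = \sum_(i < r.+1) ('C(r, i) * b ^_ i)%:R *
  (x ^+ (r - i) * (f^`(b - i + m))%classic x)).
  rewrite (sum_ord_sub _ r (fun i => ('C(r, i) * b ^_ i)%:R *
    (x ^+ (r - i) * (f^`(b - i + m))%classic x))).
  rewrite big_distrr; apply: eq_bigr => i _.
  have ir : (i <= r)%N by rewrite -ltnS.
  rewrite /= bin_sub // mulrCA; congr (_ * _).
  rewrite mulrA -exprD; congr (_ ^+ _ * _); first by lia.
  by congr ((f^`(_))%classic _); rewrite /b; lia.
rewrite (@big_ord_widen _ _ _ r.+1 b.+1 (fun i => ('C(r, i) * b ^_ i)%:R *
  (x ^+ (r - i) * (f^`(b - i + m))%classic x))) //.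
rewrite [RHS]big_mkcond; apply: eq_bigr => i _; rewrite bin_ffactC.
by case: ltnP => // ri; rewrite bin_small // mul0r.
Qed.

(** * Linear independence of the normally ordered monomials *)

Lemma ffact_free (R : numDomainType) (c : nat -> R) (q N : nat) :
  (forall l, \sum_(k < N) c k * (l ^_ (q + k))%:R = 0) ->
  forall k, (k < N)%N -> c k = 0.
Proof.
move=> H; elim/ltn_ind => k IHk kN.
(* The system is triangular: at [l = q + k] the terms beyond [k] have zero falling factorial, those
   before [k] vanish by induction, and the diagonal entry is a nonzero factorial. *)
have := H (q + k)%N; rewrite (bigD1 (Ordinal kN)) //= big1 ?addr0.
  by move/eqP; rewrite mulf_eq0 pnatr_eq0 eqn0Ngt ffact_gt0 leqnn orbF => /eqP.
move=> i; rewrite -val_eqE /= => ik; have [lt_ik|le_ki] := ltnP i k.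
  by rewrite IHk ?mul0r.
by rewrite ffact_small ?mulr0 // ltn_add2l; lia.
Qed.

Lemma normal_order_inj (R : realType) (c d : nat -> R) (p q N : nat) :
  (forall f : R -> R, smooth_pos f -> forall x : R, 0 < x ->
    \sum_(k < N) c k * (x ^+ (p + k) * (f^`(q + k))%classic x) =
    \sum_(k < N) d k * (x ^+ (p + k) * (f^`(q + k))%classic x)) ->
  forall k, (k < N)%N -> c k = d k.
Proof.
move=> H k kN; apply/eqP; rewrite -subr_eq0; apply/eqP.
apply: (ffact_free _ (fun k => c k - d k) q N _ k kN) => l.
have [sX DX] := smooth_posX R l.
have /eqP := H _ sX 1 ltr01; rewrite -subr_eq0 -sumrB => /eqP H0.
rewrite -[RHS]H0; apply: eq_bigr => i _.
by rewrite DX ?ltr01 // !expr1n mul1r mulr1 mulrBl.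
Qed.

(** * Integer-indexed coefficients and their recurrence *)

Lemma falling_natE (a l : nat) : falling a%:Z l = (a ^_ l)%:Z.
Proof.
rewrite /falling; elim: l => [|l IHl]; first by rewrite big_nil.
rewrite big_nat_recr //= IHl ffactnSr PoszM.
(* Integer and truncated differences disagree only for [l > a], where [a ^_ l] is already zero. *)
by have [la|al] := leqP l a; [rewrite subzn | rewrite ffact_small // !mul0r].
Qed.

(** Both indices are shifted by one from [stirling], with value 0 for [k <= 0]. The row [n = 0]
    merely repeats the row [n = 1]. *)
Definition gen_stirling (R : realType) (m r n : nat) (k : int) : R :=
  if k is Posz k'.+1 then (stirling m r n.-1 k')%:R else 0.

Lemma gen_stirling_eq0 (R : realType) (m r n : nat) (k : int) : (1 <= n)%N ->
  k <= 0 \/ (1 + r * (n - 1))%N%:Z < k -> gen_stirling R m r n k = 0.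
Proof.
case: n => // n _; case: k => [[|k]|k] //= [] // lt_k.
by rewrite stirling_eq0 //; lia.
Qed.

(** For [i < k] the argument of [falling] is the natural number [(n - 1)(m - r) + r + (k - 1 - i)]
    of the recurrence for [stirling]. For [i >= k] the last factor has a nonpositive index and is
    zero. *)
Lemma gen_stirlingS (R : realType) (m r n : nat) (k : int) : (r <= m)%N ->
  (2 <= n)%N -> 1 <= k ->
  gen_stirling R m r n k =
  \sum_(0 <= i < r.+1)
    (falling (m%:Z + (m%:Z - r%:Z) * (n%:Z - 2) + k - i%:Z - 1) (r - i))%:~R
      * 'C(r, i)%:R * gen_stirling R m r (n - 1)%N (k - i%:Z).
Proof.
move=> rm; case: n => [|[|n]] // _; case: k => [[|k]|k] // _.
rewrite big_mkord /gen_stirling -pred_Sn [stirling _ _ _ _]/=.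
rewrite natr_sum big_mkcond.
apply: eq_bigr => i _; case: leqP => [ik|ki].
  rewrite (_ : k.+1%:Z - i%:Z = (k - i).+1%:Z); last by lia.
  rewrite (_ : _ - 1 = ((n.+1 * (m - r) + r + (k - i))%N)%:Z); last first.
    by rewrite !PoszD PoszM -!subzn //; lia.
  rewrite falling_natE subn1 !natrM -pmulrn /=.
  by ring.
by case E : (k.+1%:Z - i%:Z) => [[|j]|j]; rewrite ?mulr0 //; lia.
Qed.

(** * Existence and uniqueness of the generalized Stirling numbers *)

Lemma sum_1_shift (V : nmodType) (N : nat) (F : nat -> V) :
  \sum_(1 <= k < (1 + N).+1) F k = \sum_(k < N.+1) F k.+1.
Proof. by rewrite big_add1 big_mkord. Qed.

(** Starting the index at 0 removes the truncated subtractions. As [S] is arbitrary, this serves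
    both existence and uniqueness. *)
Lemma gen_stirling_mr_expand (R : realType) (m r n : nat) (S : nat -> int -> R)
    (f : R -> R) (x : R) :
  \sum_(1 <= k < (1 + r * (n.+1 - 1)).+1)
    S n.+1 k%:Z * x ^+ (n.+1 * (m - r) + r + k - 1) *
      (f^`(r + k - 1))%classic x =
  \sum_(k < (r * n).+1) S n.+1 k.+1%:Z *
    (x ^+ (n.+1 * (m - r) + r + k) * (f^`(r + k))%classic x).
Proof.
rewrite sum_1_shift subn1; apply: eq_bigr => k _.
by rewrite !addnS !subn1 mulrA.
Qed.

Lemma gen_stirling_rm_expand (R : realType) (m r n : nat) (S : nat -> int -> R)
    (f : R -> R) (x : R) :
  \sum_(1 <= k < (1 + r * (n.+1 - 1)).+1)
    S n.+1 k%:Z * x ^+ (r + k - 1) *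
      (f^`(n.+1 * (m - r) + r + k - 1))%classic x =
  \sum_(k < (r * n).+1) S n.+1 k.+1%:Z *
    (x ^+ (r + k) * (f^`(n.+1 * (m - r) + r + k))%classic x).
Proof.
rewrite sum_1_shift subn1; apply: eq_bigr => k _.
by rewrite !addnS !subn1 mulrA.
Qed.

Lemma gen_stirling_mrP (R : realType) (m r : nat) :
  (r <= m)%N -> gen_stirling_mr m r (gen_stirling R m r).
Proof.
move=> rm [|n] // _; split=> [f sf x x0|k]; last exact: gen_stirling_eq0.
by rewrite gen_stirling_mr_expand iter_delta_mr.
Qed.

Lemma gen_stirling_rmP (R : realType) (m r : nat) :
  (r <= m)%N -> gen_stirling_rm m r (gen_stirling R m r).
Proof.
move=> rm [|n] // _; split=> [f sf x x0|k]; last exact: gen_stirling_eq0.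
by rewrite gen_stirling_rm_expand iter_delta_rm.
Qed.

Lemma eq_gen_stirling (R : realType) (m r n : nat) (S : int -> R) :
  (forall k : int, k <= 0 \/ (1 + r * n)%N%:Z < k -> S k = 0) ->
  (forall k, (k < (r * n).+1)%N -> S k.+1%:Z = (stirling m r n k)%:R) ->
  forall k, S k = gen_stirling R m r n.+1 k.
Proof.
move=> S0 SE [[|k]|k];
  [by rewrite S0 //; left | | by rewrite S0 //; left].
have [lt_k|lt_k] := ltnP k (r * n).+1; first by rewrite SE.
by rewrite S0 /= ?stirling_eq0 //; right.
Qed.

Lemma gen_stirling_mr_unique (R : realType) (m r : nat) (S : nat -> int -> R) :
  (r <= m)%N -> gen_stirling_mr m r S ->
  forall n k, (1 <= n)%N -> S n k = gen_stirling R m r n k.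
Proof.
move=> rm HS [|n] k // _; have [HE H0] := HS n.+1 isT.
move: k; apply: eq_gen_stirling; first by move: H0; rewrite subn1.
apply: (normal_order_inj _ (fun k => S n.+1 k.+1%:Z)
  (fun k => (stirling m r n k)%:R) (n.+1 * (m - r) + r) r) => f sf x x0.
by rewrite -gen_stirling_mr_expand -HE // iter_delta_mr.
Qed.

Lemma gen_stirling_rm_unique (R : realType) (m r : nat) (S : nat -> int -> R) :
  (r <= m)%N -> gen_stirling_rm m r S ->
  forall n k, (1 <= n)%N -> S n k = gen_stirling R m r n k.
Proof.
move=> rm HS [|n] k // _; have [HE H0] := HS n.+1 isT.
move: k; apply: eq_gen_stirling; first by move: H0; rewrite subn1.
apply: (normal_order_inj _ (fun k => S n.+1 k.+1%:Z)
  (fun k => (stirling m r n k)%:R) r (n.+1 * (m - r) + r)) => f sf x x0.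
by rewrite -gen_stirling_rm_expand -HE // iter_delta_rm.
Qed.

Theorem theorem4p9 (R : realType) (m r : nat) (hr : (1 <= r)%N)
    (hrm : (r <= m)%N) :
  (exists S : nat -> int -> R, gen_stirling_mr m r S) /\
  (exists S : nat -> int -> R, gen_stirling_rm m r S) /\
  (forall Smr Srm : nat -> int -> R,
     gen_stirling_mr m r Smr -> gen_stirling_rm m r Srm ->
     (forall (n : nat) (k : int), (1 <= n)%N -> Smr n k = Srm n k) /\
     Smr 1%N 1 = 1 /\
     (forall (n : nat) (k : int), (1 <= n)%N ->
        k <= 0 \/ (1 + r * (n - 1))%N%:Z < k -> Smr n k = 0) /\
     (forall (n : nat) (k : int), (2 <= n)%N ->
        1 <= k -> k <= (1 + r * (n - 1))%N%:Z ->
        Smr n k =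
        \sum_(0 <= i < r.+1)
          (falling (m%:Z + (m%:Z - r%:Z) * (n%:Z - 2) + k - i%:Z - 1)
                   (r - i))%:~R
          * 'C(r, i)%:R * Smr (n - 1)%N (k - i%:Z))).
Proof.
split; first by exists (gen_stirling R m r); exact: gen_stirling_mrP.
split; first by exists (gen_stirling R m r); exact: gen_stirling_rmP.
move=> Smr Srm Hmr Hrm.
(* Both families are identified with [gen_stirling], so they coincide and inherit its initial value
   and recurrence. *)
have Emr := gen_stirling_mr_unique _ _ _ _ hrm Hmr.
have Erm := gen_stirling_rm_unique _ _ _ _ hrm Hrm.
split; first by move=> n k n1; rewrite Emr // Erm.
split; first by rewrite Emr.
split; first by move=> n k n1; have [_] := Hmr n n1; apply.
move=> n k n2 k1 _; rewrite Emr; last exact: ltnW.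
rewrite gen_stirlingS //; apply: eq_bigr => i _.
by rewrite Emr // subn_gt0.
Qed.
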